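(* Let $n\ge 1$, let $\mathfrak G$ be a finite set of $n$-qubit Clifford gates, let $\mathcal G\in\mathfrak G$, and let $P_a\in\mathsf P^n$ be an $n$-qubit Pauli operator. Consider the class of all noise models for $\mathfrak G$ (as defined in the context). Then the Pauli fidelity $\lambda_a^{\mathcal G}$ of the noise channel attached to $\mathcal G$, regarded as a real-valued function of the noise model, is learnable if and only if $\mathrm{pt}(\mathcal G(P_a))=\mathrm{pt}(P_a)$.
   Context: **Paulis and patterns.** $\mathsf P^n$ is the $n$-qubit Pauli group modulo its center; its $4^n$ elements are represented by the tensor products $P_a\in\{I,X,Y,Z\}^{\otimes n}$, and $P_a$ and its label $a$ are used interchangeably. $P_{\mathbf 0}=I$. The pattern $\mathrm{pt}(P_a)\in\{0,1\}^n$ has $j$-th bit $0$ if the $j$-th tensor factor of $P_a$ is $I$, and $1$ otherwise. For a Clifford unitary $G$ we write $\mathcal G(\cdot)=G(\cdot)G^\dagger$; then $\mathcal G(P_a)$ is a Pauli operator up to a sign $\pm1$, and the sign is ignored when taking $\mathrm{pt}$. **Pauli channels.** An $n$-qubit Pauli channel is a map $\Lambda(\cdot)=\sum_{a\in\mathsf P^n}p_aP_a(\cdot)P_a$ with $p_a\ge 0$, $\sum_a p_a=1$; the $p_a$ are its Pauli error rates. It satisfies $\Lambda(P_b)=\lambda_bP_b$ with Pauli fidelities $\lambda_b=\sum_a(-1)^{\langle a,b\rangle}p_a$, where $\langle a,b\rangle=0$ if $P_a,P_b$ commute and $1$ otherwise. **Noise models.** A noise model $\mathcal N=\{\mathcal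 E^S,\mathcal E^M,(\Lambda_{\mathcal G})_{\mathcal G\in\mathfrak G}\}$ for $\mathfrak G$ consists of $n$-qubit Pauli channels: $\mathcal E^S$ (state preparation noise), $\mathcal E^M$ (measurement noise) and, for each $\mathcal G\in\mathfrak G$, a gate noise channel $\Lambda_{\mathcal G}$ with Pauli fidelities $\lambda_a^{\mathcal G}$. All Pauli fidelities and all Pauli error rates of all these channels are required to be strictly positive. **Experiments.** An experiment consists of an $n$-qubit state $\rho_0$, a POVM $\{E_o\}_o$, and a finite sequence of operations, each of which is either a tensor product $\bigotimes_{j=1}^n\mathcal U_j$ of arbitrary single-qubit unitary channels or a gate $\mathcal G\in\mathfrak G$. Under the noise model $\mathcal N$, single-qubit unitaries are implemented perfectly, each gate $\mathcal G$ is replaced by $\widetilde{\mathcal G}=\mathcal G\circ\Lambda_{\mathcal G}$, the initial state becomes $\mathcal E^S(\rho_0)$, and $\mathcal E^M$ is applied immediately before the measurement. The outcome distribution is $p_{\mathcal N}(o)=\mathrm{Tr}\big(E_o\,(\mathcal E^M\circ\widetilde{\mathcal C}\circ\mathcal E^S)(\rho_0)\big)$, where $\widetilde{\mathcal C}$ is the composition of the noisy operations. **Learnability.** Two noise models $\mathcal N_1,\mathcal N_2$ are indistinguishable if $p_{\mathcal N_1}=p_{\mathcal N_2}$ for every experiment, and distinguishable otherwise. A function $f$ of noise models is learnable if for all noise models $\mathcal N_1,\mathcal N_2$, $f(\mathcal N_1)\ne f(\mathcal N_2)$ implies that $\mathcal N_1,\mathcal N_2$ are distinguishable; it is unlearnable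 if there exist indistinguishable $\mathcal N_1,\mathcal N_2$ with $f(\mathcal N_1)\neq f(\mathcal N_2)$. *)

(* Defs.v *)
From HB Require Import structures.
From mathcomp Require Import all_boot all_order all_algebra.
From mathcomp Require Import complex.
From mathcomp Require Import boolp classical_sets cardinality reals.

Set Implicit Arguments.
Unset Strict Implicit.
Unset Printing Implicit Defensive.

Import Order.TTheory GRing.Theory Num.Theory.

Local Open Scope ring_scope.
Local Open Scope complex_scope.
Local Open Scope sesquilinear_scope.

Definition basis (n : nat) := {ffun 'I_n -> 'I_2}.
HB.instance Definition _ (n : nat) := Finite.on (basis n).

Definition dim (n : nat) : nat := #|basis n|.

(* Operators on n qubits: matrices indexed by the enumeration of the
   computational basis, dim n = 2 ^ n. *)
Definition qop (R : realType) (n : nat) := 'M[R[i]]_(dim n).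

Definition superop (R : realType) (n : nat) := qop R n -> qop R n.

Definition tensor (R : realType) (n : nat) (A : 'I_n -> 'M[R[i]]_2) : qop R n :=
  \matrix_(x, y) \prod_(j < n) A j ((enum_val x : basis n) j) ((enum_val y : basis n) j).

Definition conj_by (R : realType) (n : nat) (U : qop R n) : superop R n :=
  fun rho => U *m rho *m U^t*.

Inductive pauli1 := PI | PX | PY | PZ.

Definition bits_of_pauli1 (p : pauli1) : bool * bool :=
  match p with
  | PI => (false, false) | PX => (true, false)
  | PY => (true, true)   | PZ => (false, true)
  end.

Definition pauli1_of_bits (b : bool * bool) : pauli1 :=
  match b with
  | (false, false) => PI | (true, false) => PX
  | (true, true) => PY   | (false, true) => PZ
  end.

Lemma bits_of_pauli1K : cancel bits_of_pauli1 pauli1_of_bits.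
Proof. by case. Qed.

HB.instance Definition _ := Finite.copy pauli1 (can_type bits_of_pauli1K).

(* Elements of the Pauli group modulo its center. *)
Definition pauli (n : nat) := {ffun 'I_n -> pauli1}.
HB.instance Definition _ (n : nat) := Finite.on (pauli n).

Definition pauli1_mx (R : realType) (p : pauli1) : 'M[R[i]]_2 :=
  match p with
  | PI => 1%:M
  | PX => \matrix_(x, y) (x != y)%:R
  | PY => \matrix_(x, y) (if x == y then 0 else if x == 0 then - 'i else 'i)
  | PZ => \matrix_(x, y) (if x == y then (-1) ^+ x else 0)
  end.

Definition pauli_op (R : realType) (n : nat) (a : pauli n) : qop R n :=
  tensor (fun j => pauli1_mx R (a j)).

Definition pauli_group (R : realType) (n : nat) (A : qop R n) : Prop :=
  exists (k : nat) (a : pauli n), A = 'i ^+ k *: pauli_op R a.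

Definition is_clifford (R : realType) (n : nat) (U : qop R n) : Prop :=
  U \is unitarymx /\
  forall A : qop R n, pauli_group A <-> pauli_group (conj_by U A).

(* Gates are channels, so a Clifford unitary only matters up to global phase. *)
Definition clifford_gate (R : realType) (n : nat) (g : superop R n) : Prop :=
  exists2 U : qop R n, is_clifford U & g = conj_by U.

Definition pt (n : nat) (a : pauli n) : {ffun 'I_n -> bool} :=
  [ffun j => a j != PI].

(* The label of a signed Pauli operator, sign ignored; it is unique if it
   exists, and the default value is never reached on Clifford images of
   Pauli operators. *)
Definition pauli_label (R : realType) (n : nat) (A : qop R n) : pauli n :=
  odflt [ffun => PI]
    [pick b : pauli n | (A == pauli_op R b) || (A == - pauli_op R b)].

Definition anticomm (R : realType) (n : nat) (a b : pauli n) : bool :=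
  ~~ comm_mxb (pauli_op R a) (pauli_op R b).

Record pauli_channel (R : realType) (n : nat) := PauliChannel {
  rate : pauli n -> R;
  rate_ge0 : forall a, 0 <= rate a;
  rate_sum1 : \sum_a rate a = 1
}.

Definition channel_map (R : realType) (n : nat) (L : pauli_channel R n) :
    superop R n :=
  fun rho => \sum_a (rate L a)%:C *: (pauli_op R a *m rho *m pauli_op R a).

Definition fidelity (R : realType) (n : nat) (L : pauli_channel R n)
    (b : pauli n) : R :=
  \sum_a (-1) ^+ anticomm R a b * rate L a.

Definition positive_channel (R : realType) (n : nat) (L : pauli_channel R n) :
    Prop :=
  forall a : pauli n, 0 < rate L a /\ 0 < fidelity L a.

(* GG : set _ is coerced to the type {g | g \in GG} of its elements. *)
Record noise_model (R : realType) (n : nat) (GG : set (superop R n)) :=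
  NoiseModel {
  prep_noise : pauli_channel R n;
  meas_noise : pauli_channel R n;
  gate_noise : GG -> pauli_channel R n;
  prep_noise_gt0 : positive_channel prep_noise;
  meas_noise_gt0 : positive_channel meas_noise;
  gate_noise_gt0 : forall g : GG, positive_channel (gate_noise g)
}.

(* Over R[i], 0 <= z means that z is real and nonnegative, so this condition
   includes hermitianity. *)
Definition psd (R : realType) (n : nat) (A : qop R n) : Prop :=
  forall v : 'cV[R[i]]_(dim n), 0 <= (v^t* *m A *m v) 0 0.

Definition is_state (R : realType) (n : nat) (rho : qop R n) : Prop :=
  psd rho /\ \tr rho = 1.

Definition is_povm (R : realType) (n : nat) (O : finType) (E : O -> qop R n) :
    Prop :=
  (forall o, psd (E o)) /\ \sum_o E o = 1%:M.

Inductive operation (R : realType) (n : nat) (GG : set (superop R n)) :=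
  | LocalOp (U : 'I_n -> 'M[R[i]]_2) of (forall j, U j \is unitarymx)
  | GateOp of GG.

Record experiment (R : realType) (n : nat) (GG : set (superop R n)) :=
  Experiment {
  initial_state : qop R n;
  outcome : finType;
  povm : outcome -> qop R n;
  circuit : seq (operation GG);
  initial_stateP : is_state initial_state;
  povmP : is_povm povm
}.

(* The tensor product of the channels of the U j is conjugation by tensor U. *)
Definition noisy_op (R : realType) (n : nat) (GG : set (superop R n))
    (N : noise_model GG) (op : operation GG) : superop R n :=
  match op with
  | LocalOp U _ => conj_by (tensor U)
  | GateOp g => sval g \o channel_map (gate_noise N g)
  end.

(* The head of the circuit is applied first. *)
Definition noisy_circuit (R : realType) (n : nat) (GG : set (superop R n))
    (N : noise_model GG) (c : seq (operation GG)) : superop R n :=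
  fun rho => foldl (fun sigma op => noisy_op N op sigma) rho c.

Definition outcome_prob (R : realType) (n : nat) (GG : set (superop R n))
    (N : noise_model GG) (e : experiment GG) (o : outcome e) : R[i] :=
  \tr (povm o *m channel_map (meas_noise N)
                   (noisy_circuit N (circuit e)
                     (channel_map (prep_noise N) (initial_state e)))).

Definition indistinguishable (R : realType) (n : nat) (GG : set (superop R n))
    (N1 N2 : noise_model GG) : Prop :=
  forall (e : experiment GG) (o : outcome e),
    outcome_prob N1 o = outcome_prob N2 o.

Definition distinguishable (R : realType) (n : nat) (GG : set (superop R n))
    (N1 N2 : noise_model GG) : Prop :=
  ~ indistinguishable N1 N2.

Definition learnable (R : realType) (n : nat) (GG : set (superop R n))
    (f : noise_model GG -> R) : Prop :=
  forall N1 N2 : noise_model GG, f N1 <> f N2 -> distinguishable N1 N2.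

(* Main.v *)
(** If [pt (G P_a) = pt P_a], single-qubit unitaries rotate [G P_a] back to
    [P_a] up to sign; preparing [1 + P_a] and measuring [P_a] with the empty
    circuit, and with [G] followed by that rotation, reveals
    [lambda_a^M lambda_a^S] and [lambda_a^M lambda_a^G lambda_a^S], whose
    quotient is [lambda_a^G].  If the patterns differ, the map
    [D : P_b |-> d_b P_b] with [d_b = 1/2] when [pt P_b = pt P_a] and [d_b = 1]
    otherwise commutes with all single-qubit unitaries.  Replacing the noise by
    [D E^S], [E^M D^-1] and [D (G Lambda_G) D^-1] changes no outcome
    probability but doubles [lambda_a^G]; starting from fidelities at most
    [1 / (2 * 4^n)], the result is again a model of positive Pauli channels. *)
Require Import Defs.
From HB Require Import structures.
From mathcomp Require Import all_boot all_order all_algebra.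
From mathcomp Require Import complex.
From mathcomp Require Import boolp classical_sets cardinality reals.
From mathcomp Require Import ring lra.

Set Implicit Arguments.
Unset Strict Implicit.
Unset Printing Implicit Defensive.

Import Order.TTheory GRing.Theory Num.Theory.

Local Open Scope ring_scope.
Local Open Scope sesquilinear_scope.

(** * Single-qubit Pauli matrices *)

Definition anticomm1 (p q : pauli1) : bool := [&& p != PI, q != PI & p != q].

Lemma big_pauli1 (T : nmodType) (F : pauli1 -> T) :
  \sum_p F p = F PI + F PX + F PY + F PZ.
Proof.
rewrite (perm_big [:: PI; PX; PY; PZ]) /=; last first.
  apply: uniq_perm; [exact: index_enum_uniq | by [] |].
  by case; rewrite mem_index_enum.
by rewrite !big_cons big_nil addr0 !addrA.
Qed.

(** Orthogonality of the characters of the one-qubit Pauli group modulo phases; the [n]-qubit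
    version is a product of these sums. *)
Lemma sum_anticomm1 (R : comPzRingType) (p q : pauli1) :
  \sum_r (-1) ^+ anticomm1 r p * (-1) ^+ anticomm1 r q = (p == q)%:R *+ 4 :> R.
Proof. rewrite big_pauli1; case: p; case: q => /=; ring. Qed.

Section OneQubit.
Variable R : realType.
Local Notation C := R[i].
Local Notation sigma := (@pauli1_mx R).

Lemma mul_imaginary : 'i%R * 'i%R = -1 :> C.
Proof. by rewrite -expr2 sqrCi. Qed.

Lemma mx2P (A B : 'M[C]_2) :
  A 0 0 = B 0 0 -> A 0 1 = B 0 1 -> A 1 0 = B 1 0 -> A 1 1 = B 1 1 -> A = B.
Proof.
move=> h00 h01 h10 h11; apply/matrixP => i j.
have ord2 (k : 'I_2) : k = 0 \/ k = 1.
  by case: k => -[|[|//]] h; [left | right]; apply/val_inj.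
by case: (ord2 i) (ord2 j) => -> [] ->.
Qed.

(** The matrices are defined with the concrete imaginary unit ['i%C]; this multi-rule restates them
    with the generic ['i%R], which the algebraic lemmas speak of. *)
Lemma pauli1_mxE :
  (sigma PX = \matrix_(x, y) (x != y)%:R) * (sigma PY =
    \matrix_(x, y) (if x == y then 0 else if x == 0 then - 'i%R else 'i%R)) *
  (sigma PZ = \matrix_(x, y) (if x == y then (-1) ^+ x else 0)).
Proof. by rewrite /= complexiE. Qed.

Ltac mx2 := apply: mx2P; rewrite ?(pauli1_mxE, mxE, big_ord_recl, big_ord0) /=.

Lemma pauli1_sq p : sigma p *m sigma p = 1%:M.
Proof. by case: p; mx2; ring: mul_imaginary. Qed.

Lemma pauli1_comm p q :
  sigma p *m sigma q = (-1) ^+ anticomm1 p q *: (sigma q *m sigma p).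
Proof. by case: p; case: q; mx2; ring. Qed.

Lemma pauli1_herm p : (sigma p)^t* = sigma p.
Proof.
have conjNi : Num.conj (- 'i%R : C) = 'i%R by rewrite rmorphN /= conjCi opprK.
case: p; mx2;
  by rewrite ?(conjNi, conjCi, rmorph0, rmorph1, rmorphN, expr0, expr1).
Qed.

Lemma pauli1_trace p : \tr (sigma p) = (p == PI)%:R *+ 2.
Proof.
rewrite /mxtrace !big_ord_recl big_ord0.
by case: p; rewrite ?pauli1_mxE !mxE /=; ring.
Qed.

(** The Pauli matrices are an orthogonal basis for the trace form, each of squared norm 2. *)
Lemma pauli1_expansion (A : 'M[C]_2) :
  A = \sum_p (\tr (sigma p *m A) / 2) *: sigma p.
Proof.
have lift1 : lift ord0 ord0 = 1 :> 'I_2 by apply/val_inj.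
rewrite big_pauli1; mx2;
  rewrite /mxtrace ?(pauli1_mxE, mxE, big_ord_recl, big_ord0) /=;
  rewrite -[ord0]/(0 : 'I_2) lift1 ?(modn_small (isT : 1 < 2)%N);
  by field: mul_imaginary; rewrite ?pnatr_eq0.
Qed.
End OneQubit.

Section OneQubitUnitary.
Variable R : realType.
Local Notation sigma := (@pauli1_mx R).

Lemma pauli1_unitary_conj p q : (p == PI) = (q == PI) ->
  exists2 U : 'M[R[i]]_2, U \is unitarymx & U *m sigma p *m U^t* = sigma q.
Proof.
(* For distinct [p, q], [U] is the Hadamard-like gate
   [(sigma p + sigma q) / sqrt 2]. *)
have [<- _|npq eqI] := eqVneq p q.
  exists 1%:M; first by apply/unitarymxP; rewrite mul1mx trmx1 map_mx1.
  by rewrite mul1mx trmx1 map_mx1 mulmx1.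
(* The hypothesis on [PI] and [p != q] leave two distinct non-identity Paulis, and these
   anticommute. *)
have qp : sigma q *m sigma p = - (sigma p *m sigma q).
  rewrite pauli1_comm (_ : anticomm1 q p) ?expr1 ?scaleN1r //.
  by move: npq eqI; case: p; case: q.
pose s : R[i] := (sqrtC 2)^-1.
have sJ : s^* = s by apply/CrealP; rewrite realV ger0_real ?sqrtC_ge0.
have ss : s * s *+ 2 = 1.
  by rewrite -expr2 /s exprVn sqrtCK -mulr_natl mulfV ?pnatr_eq0.
have UJ : (s *: (sigma p + sigma q))^t* = s *: (sigma p + sigma q).
  by rewrite linearZ map_mxZ linearD map_mxD /= sJ !pauli1_herm.
have Up : (sigma p + sigma q) *m sigma p *m (sigma p + sigma q) = sigma q *+ 2.
  rewrite mulmxDl pauli1_sq qp mulmxDr !mulmxDl !mul1mx !mulNmx.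
  rewrite -!mulmxA pauli1_sq mulmx1 qp mulmxN mulmxA pauli1_sq mul1mx opprK.
  by rewrite [X in X + _]addrC addrACA subrr addr0 mulr2n.
exists (s *: (sigma p + sigma q)).
  apply/unitarymxP; rewrite UJ -scalemxAl -scalemxAr scalerA.
  rewrite mulmxDl !mulmxDr !pauli1_sq qp addrA addrK.
  by rewrite -mulr2n -scaler_nat scalerA mulr_natr ss scale1r.
rewrite UJ -scalemxAr -!scalemxAl scalerA Up.
by rewrite -scaler_nat scalerA mulr_natr ss scale1r.
Qed.
End OneQubitUnitary.

(** * Tensor products and the Pauli basis *)

Section Tensor.
Variables (R : realType) (n : nat).
Local Notation C := R[i].
Implicit Types A B : 'I_n -> 'M[C]_2.

Lemma tensor_mul A B :
  tensor A *m tensor B = tensor (fun j => A j *m B j).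
Proof.
apply/matrixP => x y; rewrite !mxE.
under [RHS]eq_bigr do rewrite mxE.
rewrite bigA_distr_bigA /= (reindex (@enum_val (basis n) predT)) /=; last first.
  exact: onW_bij (enum_val_bij _).
by apply: eq_bigr => z _; rewrite !mxE -big_split.
Qed.

Lemma trace_tensor A : \tr (tensor A) = \prod_j \tr (A j).
Proof.
rewrite /mxtrace bigA_distr_bigA /= (reindex (@enum_val (basis n) predT)) /=.
  by apply: eq_bigr => z _; rewrite !mxE.
exact: onW_bij (enum_val_bij _).
Qed.

Lemma tensor1 : tensor (fun=> 1%:M) = 1%:M :> qop R n.
Proof.
apply/matrixP => x y; rewrite !mxE; under eq_bigr do rewrite mxE.
have [->|nxy] := eqVneq x y; first by rewrite big1 // => j _; rewrite eqxx.
have [j nj] : exists j, (enum_val x : basis n) j != (enum_val y : basis n) j.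
  apply/existsP; apply: contraNT nxy => /existsPn eqxy.
  by apply/eqP/enum_val_inj/ffunP => j; have := eqxy j; rewrite negbK => /eqP.
by rewrite (bigD1 j) //= (negPf nj) mul0r.
Qed.

Lemma adj_tensor A : (tensor A)^t* = tensor (fun j => (A j)^t*).
Proof.
apply/matrixP => x y; rewrite !mxE rmorph_prod.
by apply: eq_bigr => j _; rewrite !mxE.
Qed.

Lemma tensorZ (k : 'I_n -> C) A :
  tensor (fun j => k j *: A j) = (\prod_j k j) *: tensor A.
Proof.
apply/matrixP => x y; rewrite !mxE -big_split.
by apply: eq_bigr => j _; rewrite !mxE.
Qed.

Lemma eq_tensor A B : A =1 B -> tensor A = tensor B.
Proof.
move=> eqAB; apply/matrixP => x y; rewrite !mxE.
by apply: eq_bigr => j _; rewrite eqAB.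
Qed.

(** Expanding the product of sums over the qubits gives one term per choice of a Pauli at each
    qubit, that is, per label. *)
Lemma tensor_sum (c : 'I_n -> pauli1 -> C) :
  tensor (fun j => \sum_p c j p *: pauli1_mx R p) =
  \sum_(a : pauli n) (\prod_j c j (a j)) *: pauli_op R a.
Proof.
apply/matrixP => x y; rewrite !mxE summxE.
under eq_bigr do rewrite summxE.
rewrite bigA_distr_bigA /=; apply: eq_bigr => a _; rewrite !mxE -big_split.
by apply: eq_bigr => j _; rewrite !mxE.
Qed.

Lemma delta_mx_tensor (x y : 'I_(Defs.dim n)) :
  delta_mx x y =
  tensor (fun j => delta_mx ((enum_val x : basis n) j)
                            ((enum_val y : basis n) j)) :> qop R n.
Proof.
apply/matrixP => u v; rewrite !mxE.
have eqE (s t : 'I_(Defs.dim n)) : (s == t) =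
    [forall j, (enum_val s : basis n) j == (enum_val t : basis n) j].
  apply/eqP/forallP => [-> // | eqst]; apply/enum_val_inj/ffunP => j; exact/eqP.
under eq_bigr do rewrite mxE -mulnb natrM.
rewrite big_split /= -mulnb natrM !eqE.
have prodE (P : pred 'I_n) : \prod_j (P j)%:R = [forall j, P j]%:R :> C.
  case: forallP => [allP|nP]; first by rewrite big1 // => j _; rewrite allP.
  have /existsP [j /negPf Pj] : [exists j, ~~ P j].
    by rewrite -negb_forall; apply/forallP.
  by rewrite (bigD1 j) //= Pj mul0r.
by rewrite !prodE.
Qed.

(** Paulis span all operators: a matrix unit is a tensor product of 2 by 2 matrix units, each a
    combination of Pauli matrices. Identities between superoperators are thereby checked on Paulis,
    where the noise is diagonal. *)
Lemma eq_on_pauli (f g : {linear qop R n -> qop R n}) :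
  (forall a, f (pauli_op R a) = g (pauli_op R a)) -> f =1 g.
Proof.
move=> eqfg A; rewrite (matrix_sum_delta A) !linear_sum.
apply: eq_bigr => x _; rewrite !linear_sum; apply: eq_bigr => y _.
rewrite !linearZ /=; congr (_ *: _); rewrite delta_mx_tensor.
under eq_tensor do rewrite [delta_mx _ _]pauli1_expansion.
rewrite tensor_sum !linear_sum; apply: eq_bigr => a _.
by rewrite !linearZ /= eqfg.
Qed.
End Tensor.

(** * Pauli operators, their characters and Pauli channels *)

Definition pauli0 (n : nat) : pauli n := [ffun=> PI].

Section PauliOperators.
Variables (R : realType) (n : nat).
Local Notation C := R[i].
Local Notation P := (@pauli_op R n).
Implicit Types a b c : pauli n.

Lemma pauli_op_sq a : P a *m P a = 1%:M.
Proof.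
by rewrite tensor_mul -tensor1; apply: eq_tensor => j; exact: pauli1_sq.
Qed.

Lemma pauli_op_herm a : (P a)^t* = P a.
Proof. by rewrite adj_tensor; apply: eq_tensor => j; exact: pauli1_herm. Qed.

Lemma pauli_op0 : P (pauli0 n) = 1%:M.
Proof. by rewrite -tensor1; apply: eq_tensor => j; rewrite ffunE. Qed.

Lemma dim_gt0 : (0 < Defs.dim n)%N.
Proof. by apply/card_gt0P; exists [ffun=> 0]. Qed.

Lemma dim_neq0 : (Defs.dim n)%:R != 0 :> C.
Proof. by rewrite pnatr_eq0 -lt0n dim_gt0. Qed.

Lemma trace_pauli_op a : \tr (P a) = (a == pauli0 n)%:R *+ Defs.dim n.
Proof.
have [->|na] := eqVneq a (pauli0 n); first by rewrite pauli_op0 mxtrace1.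
rewrite trace_tensor mul0rn.
have [j nj] : exists j, a j != PI.
  apply/existsP; apply: contraNT na => /existsPn eq0.
  by apply/eqP/ffunP => j; rewrite ffunE; apply/eqP; rewrite -[_ == _]negbK.
by rewrite (bigD1 j) //= pauli1_trace (negPf nj) mul0rn mul0r.
Qed.

Lemma pauli_op_neq0 a : P a != 0.
Proof.
apply/eqP => Pa0; have := pauli_op_sq a.
rewrite Pa0 mul0mx => /(congr1 mxtrace).
by rewrite mxtrace0 mxtrace1 => /esym/eqP; rewrite (negPf dim_neq0).
Qed.

Lemma signr_big_addb (S : pzRingType) (F : 'I_n -> bool) :
  (-1) ^+ (\big[addb/false]_j F j) = \prod_j (-1) ^+ F j :> S.
Proof.
apply: (big_morph (fun b : bool => (-1) ^+ b)) => // x y.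
exact: signr_addb.
Qed.

Lemma pauli_op_comm_addb a b :
  P a *m P b =
  (-1) ^+ (\big[addb/false]_j anticomm1 (a j) (b j)) *: (P b *m P a).
Proof.
rewrite signr_big_addb !tensor_mul -tensorZ.
by apply: eq_tensor => j; exact: pauli1_comm.
Qed.

(** The sign is read off qubit by qubit. When it is -1 the operators cannot also commute: that would
    give [2 *: (P b *m P a) = 0], although both factors are invertible. *)
Lemma anticommE a b :
  anticomm R a b = \big[addb/false]_j anticomm1 (a j) (b j).
Proof.
rewrite /anticomm /comm_mxb pauli_op_comm_addb.
case: (\big[addb/false]_j _) => /=; last by rewrite scale1r eqxx.
rewrite scaleN1r; apply/eqP => /eqP; rewrite eq_sym -addr_eq0 -mulr2n.
rewrite -scaler_nat scaler_eq0 pnatr_eq0 /= => /eqP /(congr1 (mulmx (P b))).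
rewrite mulmx0 mulmxA pauli_op_sq mul1mx => /eqP; apply/negP.
exact: pauli_op_neq0.
Qed.

Lemma anticomm0 a : anticomm R a (pauli0 n) = false.
Proof. by rewrite /anticomm pauli_op0 /comm_mxb mulmx1 mul1mx eqxx. Qed.

Lemma pauli_op_comm a b : P a *m P b = (-1) ^+ anticomm R a b *: (P b *m P a).
Proof. by rewrite anticommE pauli_op_comm_addb. Qed.

(** Character orthogonality: the sum factors over the qubits, and a qubit where [a] and [b] differ
    contributes the factor 0. *)
Lemma sum_sign_anticomm a b :
  \sum_c (-1) ^+ anticomm R c a * (-1) ^+ anticomm R c b =
  (a == b)%:R *+ #|pauli n| :> R.
Proof.
have [->|nab] := eqVneq a b.
  by under eq_bigr do rewrite -signr_addb addbb; rewrite sumr_const.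
rewrite mul0rn.
under eq_bigr do rewrite !anticommE !signr_big_addb -big_split.
rewrite -(bigA_distr_bigA (fun j r =>
  (-1) ^+ anticomm1 r (a j) * (-1) ^+ anticomm1 r (b j))).
have [j nj] : exists j, a j != b j.
  apply/existsP; apply: contraNT nab => /existsPn eqab.
  by apply/eqP/ffunP => j; apply/eqP; rewrite -[_ == _]negbK.
by rewrite (bigD1 j) //= sum_anticomm1 (negPf nj) mul0rn mul0r.
Qed.

(** A [channel_map] with arbitrary real coefficients, so that it also covers gauge maps, which may
    fail to be channels. [channel_map L] unfolds to [pauli_mix (rate L)]. *)
Definition pauli_mix (r : pauli n -> R) : superop R n :=
  fun rho => \sum_a (r a)%:C%C *: (P a *m rho *m P a).

Lemma pauli_mix_is_linear r : linear (pauli_mix r).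
Proof.
move=> k A B; rewrite /pauli_mix scaler_sumr -big_split; apply: eq_bigr => a _.
by rewrite mulmxDr mulmxDl -scalemxAr -scalemxAl scalerDr !scalerA mulrC.
Qed.

HB.instance Definition _ r :=
  GRing.isLinear.Build C (qop R n) (qop R n) _ (pauli_mix r)
    (pauli_mix_is_linear r).

Lemma conj_by_is_linear (U : qop R n) : linear (conj_by U).
Proof.
by move=> k A B; rewrite /conj_by mulmxDr mulmxDl -scalemxAr -scalemxAl.
Qed.

HB.instance Definition _ U :=
  GRing.isLinear.Build C (qop R n) (qop R n) _ (conj_by U)
    (conj_by_is_linear U).

Lemma pauli_mix_pauli_op r b :
  pauli_mix r (P b) = (\sum_a (-1) ^+ anticomm R a b * r a)%:C%C *: P b.
Proof.
rewrite /pauli_mix rmorph_sum scaler_suml; apply: eq_bigr => a _.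
rewrite pauli_op_comm -scalemxAl -mulmxA pauli_op_sq mulmx1 scalerA.
by rewrite rmorphM rmorph_sign mulrC.
Qed.

(** The inverse Walsh-Hadamard transform: from prescribed eigenvalues on the Paulis to the
    coefficients of a Pauli mixture. *)
Definition rates_of (d : pauli n -> R) (a : pauli n) : R :=
  (\sum_b (-1) ^+ anticomm R a b * d b) / #|pauli n|%:R.

Lemma card_pauli_gt0 : (0 < #|pauli n|)%N.
Proof. by apply/card_gt0P; exists (pauli0 n). Qed.

Lemma sum_rates_of d b : \sum_a (-1) ^+ anticomm R a b * rates_of d a = d b.
Proof.
rewrite /rates_of; under eq_bigr do rewrite mulrA mulr_sumr.
rewrite -mulr_suml exchange_big /=.
under eq_bigr => c _.
  under eq_bigr do rewrite mulrA.
  rewrite -mulr_suml sum_sign_anticomm; over.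
rewrite (bigD1 b) //= eqxx big1 => [|c ncb].
  by rewrite addr0 mulrAC mulfV ?mul1r // pnatr_eq0 -lt0n card_pauli_gt0.
by rewrite eq_sym (negPf ncb) mul0rn mul0r.
Qed.

(** Up to normalisation a rate is a signed sum of the [d b]: the identity contributes 1 and each
    other term at least minus the inverse of [#|pauli n|], so the rate is positive. *)
Lemma channel_of_fidelities (d : pauli n -> R) :
  d (pauli0 n) = 1 -> (forall b, 0 < d b) ->
  (forall b, b != pauli0 n -> d b <= #|pauli n|%:R^-1) ->
  {L : pauli_channel R n | positive_channel L & fidelity L =1 d}.
Proof.
move=> d0 d_gt0 d_le.
have K_gt0 : 0 < #|pauli n|%:R :> R by rewrite ltr0n card_pauli_gt0.
have r_gt0 a : 0 < rates_of d a.
  rewrite divr_gt0 // (bigD1 (pauli0 n)) //= anticomm0 mul1r d0.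
  rewrite -ltrBlDl sub0r ltrNl -sumrN.
  apply: (@le_lt_trans _ _ (\sum_(b | b != pauli0 n) #|pauli n|%:R^-1)).
    apply: ler_sum => b nb; rewrite -mulNr (le_trans _ (d_le b nb)) //.
    case: anticomm; rewrite ?opprK ?mul1r // mulN1r.
    by rewrite (le_trans _ (ltW (d_gt0 b))) // oppr_le0 ltW.
  (* All [#|pauli n|] copies sum to 1; leaving out the identity term makes the inequality strict. *)
  have : \sum_(b : pauli n) #|pauli n|%:R^-1 = 1 :> R.
    by rewrite sumr_const -[LHS]mulr_natl mulfV ?gt_eqF.
  rewrite (bigD1 (pauli0 n)) //= => h.
  by rewrite -subr_gt0 -[X in X - _]h addrK invr_gt0.
have r_sum1 : \sum_a rates_of d a = 1.
  rewrite -d0 -[RHS]sum_rates_of; apply: eq_bigr => a _.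
  by rewrite anticomm0 mul1r.
exists (PauliChannel (fun a => ltW (r_gt0 a)) r_sum1).
  by move=> a; split; [exact: r_gt0 | rewrite /fidelity /= sum_rates_of].
by move=> b; rewrite /fidelity /= sum_rates_of.
Qed.

Lemma channel_map_pauli_op (L : pauli_channel R n) b :
  channel_map L (P b) = (fidelity L b)%:C%C *: P b.
Proof. exact: pauli_mix_pauli_op. Qed.
End PauliOperators.

(** * Clifford action on Pauli labels *)

Section Clifford.
Variables (R : realType) (n : nat).
Local Notation P := (@pauli_op R n).

(** The image is a Pauli up to a power of ['i]; as it squares to the identity, that phase is a
    sign. *)
Lemma pauli_label_clifford (U : qop R n) (a : pauli n) : is_clifford U ->
  exists s : bool,
    conj_by U (P a) = (-1) ^+ s *: P (pauli_label (conj_by U (P a))).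
Proof.
case=> unitU cliffU.
have [k [c Ec]] : pauli_group (conj_by U (P a)).
  by apply: (proj1 (cliffU _)); exists 0%N, a; rewrite expr0 scale1r.
have [s Es] : exists s : bool, conj_by U (P a) = (-1) ^+ s *: P c.
  have : conj_by U (P a) *m conj_by U (P a) = 1%:M.
    rewrite /conj_by -!mulmxA (mulmxA _ U) (mulmx1C (unitarymxP unitU)) mul1mx.
    by rewrite (mulmxA (P a) (P a)) pauli_op_sq mul1mx; apply/unitarymxP.
  rewrite Ec -scalemxAl -scalemxAr scalerA pauli_op_sq => /(congr1 mxtrace).
  rewrite mxtraceZ mxtrace1 -[RHS]mul1r => /(mulIf (dim_neq0 R n)) /eqP.
  rewrite -expr2 sqrf_eq1 => /orP[] /eqP ->; first by exists false.
  by exists true.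
(* The branch where [pick] fails and the default label is returned is refuted by [c]. *)
rewrite /pauli_label; case: pickP => [b /orP[] /eqP -> | /(_ c)].
- by exists false; rewrite scale1r.
- by exists true; rewrite scaleN1r.
by rewrite Es; case: s {Es}; rewrite ?scale1r ?scaleN1r eqxx ?orbT.
Qed.

(** Conjugation fixes the identity, and no other Pauli has nonzero trace. *)
Lemma pauli_label_clifford0 (U : qop R n) : is_clifford U ->
  pauli_label (conj_by U (P (pauli0 n))) = pauli0 n.
Proof.
move=> cliffU; have [s] := pauli_label_clifford (pauli0 n) cliffU.
set b := pauli_label _; rewrite /conj_by pauli_op0 mulmx1.
rewrite (unitarymxP (proj1 cliffU)) => /(congr1 mxtrace).
rewrite mxtrace1 mxtraceZ trace_pauli_op; case: eqP => // _ /eqP.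
by rewrite mul0rn mulr0 (negPf (dim_neq0 R n)).
Qed.
End Clifford.

(** * Gauge transformations of noise models *)

Section Gauge.
Variables (R : realType) (n : nat).
Local Notation P := (@pauli_op R n).

(** Conjugation by a local unitary acts factor by factor, fixes identity factors and keeps the
    others traceless, so only Paulis of the same pattern occur. *)
Lemma conj_tensor_pauli_op (U : 'I_n -> 'M[R[i]]_2) (b : pauli n) :
  (forall j, U j \is unitarymx) ->
  exists2 k : pauli n -> R[i], conj_by (tensor U) (P b) = \sum_c k c *: P c &
    forall c, pt c != pt b -> k c = 0.
Proof.
move=> unitU; pose A j := U j *m pauli1_mx R (b j) *m (U j)^t*.
exists (fun c => \prod_j (\tr (pauli1_mx R (c j) *m A j) / 2)).
  rewrite /conj_by adj_tensor !tensor_mul.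
  rewrite -(tensor_sum (fun j p => \tr (pauli1_mx R p *m A j) / 2)).
  by apply: eq_tensor => j; exact: pauli1_expansion.
move=> c npt.
have [j] : exists j, pt c j != pt b j.
  apply/existsP; apply: contraNT npt => /existsPn eqpt.
  by apply/eqP/ffunP => j; apply/eqP; rewrite -[_ == _]negbK.
rewrite !ffunE (inj_eq negb_inj) => nj; rewrite (bigD1 j) //=.
suff -> : \tr (pauli1_mx R (c j) *m A j) = 0 by rewrite !mul0r.
(* Either the factor of [b] is the identity, hence fixed and orthogonal to the nontrivial [c j]; or
   [c j] is the identity and the trace is that of the traceless factor of [b]. *)
have [bj|bj] := eqVneq (b j) PI.
  rewrite /A bj mulmx1 (unitarymxP (unitU j)) mulmx1 pauli1_trace.
  by move: nj; rewrite bj eqxx eqb_id => /negPf ->; rewrite mul0rn.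
move: nj; rewrite (negPf bj) eqbF_neg negbK => /eqP ->.
rewrite mul1mx /A mxtrace_mulC mulmxA (mulmx1C (unitarymxP (unitU j))) mul1mx.
by rewrite pauli1_trace (negPf bj) mul0rn.
Qed.

Lemma pauli_mix_rates_of (d : pauli n -> R) b :
  pauli_mix (rates_of d) (P b) = (d b)%:C%C *: P b.
Proof. by rewrite pauli_mix_pauli_op sum_rates_of. Qed.

(** Local unitaries mix only Paulis of one pattern, on which the map is a scalar. *)
Lemma pauli_mix_local (d : pauli n -> R) (U : 'I_n -> 'M[R[i]]_2) rho :
  (forall b c, pt b = pt c -> d b = d c) -> (forall j, U j \is unitarymx) ->
  conj_by (tensor U) (pauli_mix (rates_of d) rho) =
  pauli_mix (rates_of d) (conj_by (tensor U) rho).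
Proof.
move=> d_pt unitU.
apply: (eq_on_pauli (f := conj_by (tensor U) \o pauli_mix (rates_of d))
                    (g := pauli_mix (rates_of d) \o conj_by (tensor U)))
  => b /=.
rewrite pauli_mix_rates_of linearZ /=.
have [k -> k0] := conj_tensor_pauli_op b unitU.
rewrite [RHS]linear_sum scaler_sumr; apply: eq_bigr => c _.
rewrite [RHS]linearZ /= pauli_mix_rates_of !scalerA mulrC.
have [/d_pt -> //|/k0 ->] := eqVneq (pt c) (pt b).
by rewrite !mul0r.
Qed.

Variable GG : set (superop R n).
Hypothesis GG_clifford : forall g : GG, clifford_gate (sval g).

(* [D : P_b |-> d b P_b] is a change of gauge: [D] is applied after the state
   preparation, every noisy gate is conjugated by [D] and [D^-1] is applied
   before the measurement. *)
Lemma gauge_indistinguishable (N1 N2 : noise_model GG) (d : pauli n -> R) :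
  (forall b c, pt b = pt c -> d b = d c) ->
  (forall b, fidelity (prep_noise N2) b = d b * fidelity (prep_noise N1) b) ->
  (forall b, fidelity (meas_noise N2) b * d b = fidelity (meas_noise N1) b) ->
  (forall g b, fidelity (gate_noise N2 g) b * d b =
     d (pauli_label (sval g (P b))) * fidelity (gate_noise N1 g) b) ->
  indistinguishable N1 N2.
Proof.
move=> d_pt fidS fidM fidG e o.
pose r := rates_of d.
have rE b : pauli_mix r (P b) = (d b)%:C%C *: P b by exact: pauli_mix_rates_of.
have chanE (L : pauli_channel R n) b :
    pauli_mix (rate L) (P b) = (fidelity L b)%:C%C *: P b.
  exact: channel_map_pauli_op.
have prepE rho :
    channel_map (prep_noise N2) rho =
    pauli_mix r (channel_map (prep_noise N1) rho).
  apply: (eq_on_pauli (f := pauli_mix (rate (prep_noise N2)))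
     (g := pauli_mix r \o pauli_mix (rate (prep_noise N1)))) => b /=.
  by rewrite !chanE [RHS]linearZ /= rE scalerA fidS rmorphM mulrC.
have measE rho :
    channel_map (meas_noise N2) (pauli_mix r rho) =
    channel_map (meas_noise N1) rho.
  apply: (eq_on_pauli (f := pauli_mix (rate (meas_noise N2)) \o pauli_mix r)
     (g := pauli_mix (rate (meas_noise N1)))) => b /=.
  by rewrite rE [LHS]linearZ /= !chanE scalerA -fidM rmorphM mulrC.
have opE op rho :
    noisy_op N2 op (pauli_mix r rho) = pauli_mix r (noisy_op N1 op rho).
  case: op => [U unitU|g] /=; first exact: pauli_mix_local.
  have [U cliffU gE] := GG_clifford g; move: (fidG g); rewrite gE => fidgG.
  apply: (eq_on_pauli
     (f := conj_by U \o (pauli_mix (rate (gate_noise N2 g)) \o pauli_mix r))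
     (g := pauli_mix r \o (conj_by U \o pauli_mix (rate (gate_noise N1 g)))))
     => b /=.
  rewrite rE chanE [X in conj_by U X]linearZ /= chanE.
  rewrite scalerA -rmorphM mulrC fidgG rmorphM.
  have [s] := pauli_label_clifford b cliffU; move: (pauli_label _) => l ub.
  rewrite [LHS]linearZ [X in pauli_mix r X]linearZ /= [RHS]linearZ /= ub.
  rewrite [X in _ = _ *: X]linearZ /= rE !scalerA; congr (_ *: _).
  by rewrite -[LHS]mulrA [LHS]mulrC.
rewrite /outcome_prob /noisy_circuit prepE.
set rho := channel_map (prep_noise N1) _.
(* The gauge map created by the preparation is carried past the operations one at a time, until the
   measurement noise absorbs it. *)
have -> : foldl (fun s op => noisy_op N2 op s) (pauli_mix r rho) (circuit e) =
          pauli_mix r (foldl (fun s op => noisy_op N1 op s) rho (circuit e)).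
  elim: (circuit e) rho => [|op ops IH] rho; first by [].
  by rewrite [LHS]/= [X in _ = pauli_mix r X]/= opE IH.
by rewrite measE.
Qed.
End Gauge.

(** * Changed pattern: two indistinguishable models *)

Section Unlearnable.
Variables (R : realType) (n : nat) (GG : set (superop R n)).
Hypothesis GG_clifford : forall g : GG, clifford_gate (sval g).
Local Notation P := (@pauli_op R n).

Lemma pt_eq0 (b : pauli n) : (pt b == pt (pauli0 n)) = (b == pauli0 n).
Proof.
apply/eqP/eqP => [/ffunP eqpt|-> //]; apply/ffunP => j.
by have := eqpt j; rewrite !ffunE eqxx => /negbFE /eqP.
Qed.

(** Half of the bound in [channel_of_fidelities], which leaves room for a gauge factor of up to
    2. *)
Let base (b : pauli n) : R :=
  if b == pauli0 n then 1 else #|pauli n|%:R^-1 / 2.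

Lemma rescaled_channel (m : pauli n -> R) :
  m (pauli0 n) = 1 -> (forall b, 0 < m b <= 2) ->
  {L : pauli_channel R n | positive_channel L &
    fidelity L =1 fun b => base b * m b}.
Proof.
move=> m0 m_bound.
have K_gt0 : 0 < #|pauli n|%:R^-1 :> R.
  by rewrite invr_gt0 ltr0n card_pauli_gt0.
have base_gt0 b : 0 < base b.
  by rewrite /base; case: ifP => // _; rewrite divr_gt0.
apply: channel_of_fidelities => [|b|b /negPf nb0].
- by rewrite /base eqxx mul1r.
- by rewrite mulr_gt0 //; case/andP: (m_bound b).
rewrite /base nb0 -mulrA ger_pMr // mulrC ler_pdivrMr // mul1r.
by case/andP: (m_bound b).
Qed.

Lemma unlearnable_fidelity (g : GG) (a : pauli n) :
  pt (pauli_label (sval g (P a))) != pt a ->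
  ~ learnable (fun N : noise_model GG => fidelity (gate_noise N g) a).
Proof.
move=> npt learn.
have label0 (h : GG) : pauli_label (sval h (P (pauli0 n))) = pauli0 n.
  by have [U cliffU ->] := GG_clifford h; exact: pauli_label_clifford0.
(* The identity keeps its pattern under every gate, so it is excluded; hence [d] is 1 there and
   trace preservation survives the gauge change. *)
have a_neq0 : a != pauli0 n by apply: contraNneq npt => ->; rewrite label0.
pose d b : R := if pt b == pt a then 2^-1 else 1.
have d0 : d (pauli0 n) = 1 by rewrite /d eq_sym pt_eq0 (negPf a_neq0).
have d_half b : d b = 2^-1 \/ d b = 1 by rewrite /d; case: ifP; [left|right].
have d_neq0 b : d b != 0 by case: (d_half b) => ->; lra.
have [L0 L0_gt0 L0E] : {L : pauli_channel R n | positive_channel L &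
    fidelity L =1 fun b => base b * 1} by apply: rescaled_channel => // b; lra.
have [S S_gt0 SE] : {L : pauli_channel R n | positive_channel L &
    fidelity L =1 fun b => base b * d b}.
  by apply: rescaled_channel => // b; case: (d_half b) => ->; lra.
have [M M_gt0 ME] : {L : pauli_channel R n | positive_channel L &
    fidelity L =1 fun b => base b * (d b)^-1}.
  apply: rescaled_channel => [|b]; first by rewrite d0 invr1.
  by case: (d_half b) => ->; rewrite ?invrK ?invr1; lra.
(* Since [d] takes only the values 1/2 and 1, the quotient is 1/2, 1 or 2. *)
have gateL (h : GG) : {L : pauli_channel R n | positive_channel L &
    fidelity L =1 fun b => base b * (d (pauli_label (sval h (P b))) / d b)}.
  apply: rescaled_channel => [|b]; first by rewrite label0 d0 divr1.
  by case: (d_half b) (d_half (pauli_label (sval h (P b)))) => -> [] ->;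
    rewrite ?invrK ?invr1; lra.
pose N1 := NoiseModel L0_gt0 L0_gt0 (fun _ : GG => L0_gt0).
pose N2 := @NoiseModel R n GG S M (fun h => s2val (gateL h)) S_gt0 M_gt0
  (fun h => s2valP (gateL h)).
apply: (learn N1 N2).
  (* At [a] the quotient is 1 over 1/2, because the image has another pattern; equality of the two
     fidelities would mean [base a = 2 * base a]. *)
  rewrite /= L0E (s2valP' (gateL g)) mulr1 /d (negPf npt) eqxx mul1r invrK.
  rewrite /base (negPf a_neq0) => /eqP.
  rewrite -subr_eq0 -[X in X - _]mulr1 -mulrBr !mulf_eq0 !invr_eq0 !pnatr_eq0.
  rewrite (gtn_eqF (card_pauli_gt0 n)) /=; lra.
apply: (gauge_indistinguishable GG_clifford (d := d)) => [b c eqpt|b|b|h b] /=.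
- by rewrite /d eqpt.
- by rewrite SE L0E mulr1 mulrC.
- by rewrite ME L0E mulr1 divfK.
- by rewrite (s2valP' (gateL h)) L0E mulr1 mulrA divfK // mulrC.
Qed.
End Unlearnable.

(** * Preserved pattern: two experiments that determine the fidelity *)

Section Learnable.
Variables (R : realType) (n : nat).
Local Notation P := (@pauli_op R n).

Lemma fidelity0 (L : pauli_channel R n) : fidelity L (pauli0 n) = 1.
Proof.
by rewrite -(rate_sum1 L); apply: eq_bigr => a _; rewrite anticomm0 mul1r.
Qed.

(** The operator [Q] is hermitian with [Q *m Q = 2 *: Q], so [k *: Q] is a nonnegative multiple of
    [Q^t* *m Q]. *)
Lemma psd_pauli_projector (k : R[i]) (s : bool) (a : pauli n) :
  0 <= k -> psd (k *: (1%:M + (-1) ^+ s *: P a)).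
Proof.
move=> k_ge0 v; set Q := 1%:M + _.
have QJ : Q^t* = Q.
  rewrite /Q linearD /= trmx1 map_mxD map_mx1 linearZ map_mxZ /= pauli_op_herm.
  by rewrite rmorph_sign.
have QQ : Q *m Q = 2 *: Q.
  rewrite /Q mulmxDl !mulmxDr !mul1mx mulmx1 -scalemxAl -scalemxAr scalerA.
  rewrite -signr_addb addbb pauli_op_sq scale1r.
  by rewrite [X in _ + X]addrC -mulr2n scaler_nat.
have -> : k *: Q = (k / 2) *: (Q^t* *m Q).
  by rewrite QJ QQ scalerA divfK // pnatr_eq0.
rewrite -scalemxAr -scalemxAl mxE mulr_ge0 ?divr_ge0 //.
rewrite (_ : v^t* *m (Q^t* *m Q) *m v = (Q *m v)^t* *m (Q *m v)); last first.
  by rewrite trmx_mul map_mxM !mulmxA.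
rewrite mxE sumr_ge0 // => i _.
by rewrite !mxE mulrC mul_conjC_ge0.
Qed.

(** For [a != pauli0 n], the projector onto an eigenspace of [P a]; [false] stands for the
    eigenvalue +1. *)
Definition pauli_effect (a : pauli n) (s : bool) : qop R n :=
  2^-1 *: (1%:M + (-1) ^+ s *: P a).

(** The real [x] is unrestricted: it records the coefficient of the Pauli as noise and gates rescale
    it. Only [x = 1] serves as an initial state. *)
Definition pauli_state (a : pauli n) (x : R) : qop R n :=
  (Defs.dim n)%:R^-1 *: (1%:M + x%:C%C *: P a).

Lemma pauli_effect_povm a : is_povm (pauli_effect a).
Proof.
split=> [s|]; first by apply: psd_pauli_projector; rewrite invr_ge0.
rewrite big_bool /pauli_effect /= -scalerDr expr1 expr0 scaleN1r scale1r.
rewrite addrACA addNr addr0 -mulr2n -[X in _ *: X]scaler_nat.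
by rewrite scalerA mulVf ?scale1r ?pnatr_eq0.
Qed.

Lemma pauli_state_state a : a != pauli0 n -> is_state (pauli_state a 1).
Proof.
move=> /negPf na; split.
  have := @psd_pauli_projector (Defs.dim n)%:R^-1 false a.
  by rewrite expr0 /pauli_state rmorph1; apply; rewrite invr_ge0.
rewrite mxtraceZ mxtraceD mxtrace1 mxtraceZ trace_pauli_op na.
by rewrite mul0rn mulr0 addr0 mulVf // dim_neq0.
Qed.

Lemma trace_pauli_effect a x : a != pauli0 n ->
  \tr (pauli_effect a false *m pauli_state a x) = ((1 + x) / 2)%:C%C.
Proof.
move=> /negPf na; rewrite -scalemxAl -scalemxAr expr0 scale1r.
rewrite mulmxDl !mulmxDr !mul1mx mulmx1 -scalemxAr pauli_op_sq.
rewrite !mxtraceZ !mxtraceD !mxtraceZ trace_pauli_op mxtrace1 na mul0rn.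
rewrite mulr0 addr0 add0r rmorphM rmorphD rmorph1 fmorphV rmorph_nat.
by field; rewrite dim_neq0.
Qed.

Lemma map_pauli_state (f : {linear qop R n -> qop R n}) a b (x y : R) :
  f 1%:M = 1%:M -> f (P a) = y%:C%C *: P b ->
  f (pauli_state a x) = pauli_state b (x * y).
Proof.
move=> f1 fa; rewrite /pauli_state linearZ /= linearD /= linearZ /= f1 fa.
by rewrite scalerA rmorphM.
Qed.

Lemma channel_pauli_state (L : pauli_channel R n) a x :
  channel_map L (pauli_state a x) = pauli_state a (x * fidelity L a).
Proof.
apply: (map_pauli_state (f := pauli_mix (rate L))).
  by rewrite -pauli_op0 [LHS]channel_map_pauli_op fidelity0 rmorph1 scale1r.
exact: channel_map_pauli_op.
Qed.

Lemma tensor_unitary (U : 'I_n -> 'M[R[i]]_2) :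
  (forall j, U j \is unitarymx) -> tensor U \is unitarymx.
Proof.
move=> unitU; apply/unitarymxP; rewrite adj_tensor tensor_mul -tensor1.
by apply: eq_tensor => j; exact/unitarymxP.
Qed.

Lemma conj_pauli_state (U : qop R n) a b s x :
  U \is unitarymx -> conj_by U (P a) = (-1) ^+ s *: P b ->
  conj_by U (pauli_state a x) = pauli_state b (x * (-1) ^+ s).
Proof.
move=> unitU Ua; apply: (map_pauli_state (f := conj_by U)).
  by rewrite /= /conj_by mulmx1; exact/unitarymxP.
by rewrite /= Ua rmorph_sign.
Qed.

Lemma pauli_local_rotation (a b : pauli n) : pt a = pt b ->
  exists2 U : 'I_n -> 'M[R[i]]_2, forall j, U j \is unitarymx &
    conj_by (tensor U) (P a) = P b.
Proof.
move=> /ffunP eqpt.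
have ex j : exists U : 'M[R[i]]_2,
    U \is unitarymx /\ U *m pauli1_mx R (a j) *m U^t* = pauli1_mx R (b j).
  have [|U unitU UE] := @pauli1_unitary_conj R (a j) (b j); last by exists U.
  by have := eqpt j; rewrite !ffunE => /negb_inj.
have [U UP] := choice ex.
exists U => [j|]; first by have [] := UP j.
rewrite /conj_by adj_tensor !tensor_mul; apply: eq_tensor => j.
by have [] := UP j.
Qed.

Variable GG : set (superop R n).

(** A circuit that rescales the Pauli coefficient by [y] contributes just that factor, between the
    preparation and measurement fidelities. The hypothesis ranges over all [x] because preparation
    noise acts first. *)
Lemma outcome_prob_pauli_effect (N : noise_model GG) (c : seq (operation GG))
    (a : pauli n) (a_neq0 : a != pauli0 n) (y : R) :
  (forall x, noisy_circuit N c (pauli_state a x) = pauli_state a (x * y)) ->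
  outcome_prob N (e := Experiment c (pauli_state_state a_neq0)
                                    (pauli_effect_povm a)) false =
  ((1 + fidelity (prep_noise N) a * y * fidelity (meas_noise N) a) / 2)%:C%C.
Proof.
move=> cE; rewrite -(trace_pauli_effect _ a_neq0).
congr (\tr (_ *m _)).
have -> : channel_map (prep_noise N) (pauli_state a 1) =
          pauli_state a (fidelity (prep_noise N) a).
  by rewrite channel_pauli_state mul1r.
by rewrite cE channel_pauli_state.
Qed.

Hypothesis GG_clifford : forall g : GG, clifford_gate (sval g).

Lemma learnable_fidelity (g : GG) (a : pauli n) :
  pt (pauli_label (sval g (P a))) = pt a ->
  learnable (fun N : noise_model GG => fidelity (gate_noise N g) a).
Proof.
move=> eqpt N1 N2; apply: contra_not => indist.
(* The identity has fidelity 1 in every model; the test state below requires a nontrivial Pauli. *)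
have [->|a_neq0] := eqVneq a (pauli0 n); first by rewrite !fidelity0.
have [U cliffU gE] := GG_clifford g; rewrite gE in eqpt.
have [s] := pauli_label_clifford a cliffU.
move: (pauli_label _) eqpt => l eqpt gPa.
have [V unitV VP] := pauli_local_rotation eqpt.
have local x : conj_by (tensor V) (pauli_state l x) = pauli_state a x.
  rewrite (conj_pauli_state (s := false) (b := a) _ (tensor_unitary unitV)).
    by rewrite expr0 mulr1.
  by rewrite VP scale1r.
have circuitE (N : noise_model GG) x :
    noisy_circuit N [:: GateOp g; LocalOp GG unitV] (pauli_state a x) =
    pauli_state a (x * (fidelity (gate_noise N g) a * (-1) ^+ s)).
  transitivity (conj_by (tensor V)
      (sval g (channel_map (gate_noise N g) (pauli_state a x)))); first by [].
  rewrite channel_pauli_state gE (conj_pauli_state _ (proj1 cliffU) gPa).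
  by rewrite local mulrA.
have emptyE (N : noise_model GG) x :
    noisy_circuit N [::] (pauli_state a x) = pauli_state a (x * 1).
  by rewrite mulr1.
have prob_inj x y : ((1 + x) / 2)%:C%C = ((1 + y) / 2)%:C%C :> R[i] -> x = y.
  by move=> /complexI h; lra.
have e0 := indist (Experiment [::] (pauli_state_state a_neq0)
                              (pauli_effect_povm a)) false.
rewrite !(outcome_prob_pauli_effect a_neq0 (emptyE _)) in e0.
have e1 := indist (Experiment [:: GateOp g; LocalOp GG unitV]
                     (pauli_state_state a_neq0) (pauli_effect_povm a)) false.
rewrite !(outcome_prob_pauli_effect a_neq0 (circuitE _)) in e1.
(* Here [p], [m] and [x] are the preparation, measurement and gate fidelities, and [t] is the sign
   from the Clifford, common to both models. Dividing the second equation by the first isolates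
   [x]. *)
have cancel (x1 x2 p1 p2 m1 m2 t : R) : 0 < p1 -> 0 < m1 -> t != 0 ->
    p1 * 1 * m1 = p2 * 1 * m2 -> p1 * (x1 * t) * m1 = p2 * (x2 * t) * m2 ->
    x1 = x2.
  move=> p1_gt0 m1_gt0 t_neq0 eq0 eq1.
  have c_neq0 : p1 * 1 * m1 * t != 0 by rewrite mulr1 !mulf_neq0 // gt_eqF.
  apply: (mulfI c_neq0); transitivity (p1 * (x1 * t) * m1); first by ring.
  by rewrite eq1 eq0; ring.
have [_ S1_gt0] := prep_noise_gt0 N1 a; have [_ M1_gt0] := meas_noise_gt0 N1 a.
have sign_neq0 : (-1) ^+ s != 0 :> R by rewrite signr_eq0.
exact: cancel S1_gt0 M1_gt0 sign_neq0 (prob_inj _ _ e0) (prob_inj _ _ e1).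
Qed.
End Learnable.

Theorem theorem1 (R : realType) (n : nat) (GG : set (superop R n))
    (n_gt0 : (0 < n)%N)
    (GG_fin : finite_set GG)
    (GG_clifford : forall g : GG, clifford_gate (sval g))
    (g : GG) (a : pauli n) :
  learnable (fun N : noise_model GG => fidelity (gate_noise N g) a) <->
  pt (pauli_label (sval g (pauli_op R a))) = pt a.
Proof.
split; last exact: learnable_fidelity.
move=> learn; apply/eqP/negP => /negP npt.
exact: unlearnable_fidelity npt learn.
Qed.
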